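(* Let $A \in \mathbb{C}^{N\times N}$ be a positive semidefinite matrix, let $r \ge 1$ be an integer, and let $\varepsilon > 0$. Let $\widehat{A}^{(k)}$ denote the output of $k \ge r$ steps of the randomly pivoted Cholesky algorithm on $A$. Then $$\mathbb{P}\bigl\{ \operatorname{tr}(A - \widehat{A}^{(k)}) \ge (1+\varepsilon) \operatorname{tr}(A - [A]_r) \bigr\} \le \frac{k!}{(k-r)!}\cdot (1+\varepsilon)^{-(k-r)}.$$
   Context: A matrix $A\in\mathbb{C}^{N\times N}$ is positive semidefinite (psd) if it equals its adjoint, $A = A^*$, and all its eigenvalues are nonnegative. $[A]_r$ denotes the optimal rank-$r$ approximation to $A$ in any unitarily invariant norm, so that $\operatorname{tr}(A-[A]_r)=\sum_{i>r}\lambda_i(A)$ with eigenvalues $\lambda_1(A)\ge\cdots\ge\lambda_N(A)$. Randomly pivoted Cholesky algorithm on $A$: set $\widehat{A}^{(0)} = 0$. At step $i=1,2,\dots$, draw a random pivot index $s_i\in\{1,\dots,N\}$ using the diagonal of the current residual as sampling weights, that is, conditionally on the past, $$\mathbb{P}\{s_i = t\} = \frac{A(t,t) - \widehat{A}^{(i-1)}(t,t)}{\operatorname{tr}(A - \widehat{A}^{(i-1)})},$$ let $v_i = A(:,s_i) - \widehat{A}^{(i-1)}(:,s_i)$ (the $s_i$-th column of $A-\widehat{A}^{(i-1)}$), and set $\widehat{A}^{(i)} = \widehat{A}^{(i-1)} + v_i v_i^*/v_i(s_i)$, where $v_i(s_i)$ is the $s_i$-th entry of $v_i$. The output of $k$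 steps is $\widehat{A}^{(k)}$.
   Formalization: For k > r it is assumed that tr(A − [A]_r) > 0 (rank A > r); otherwise the algorithm meets 0/0 weights, and with the residual kept at zero the event has probability one while the bound can be below one (e.g. A = (1), r = 1, k = 2, ε = 2 gives 2/3). *)

(* Defs.v *)
From HB Require Import structures.
From mathcomp Require Import all_boot all_order all_algebra.
From mathcomp Require Import all_classical all_reals all_analysis.
From mathcomp Require Import complex.

Set Implicit Arguments.
Unset Strict Implicit.
Unset Printing Implicit Defensive.

Import Order.TTheory GRing.Theory Num.Theory.

Local Open Scope classical_set_scope.
Local Open Scope ring_scope.
Local Open Scope sesquilinear_scope.

(* In R[i], [0 <= a] means that a is real and nonnegative. *)
Definition psdmx (R : realType) (N : nat) (A : 'M[R[i]]_N) : Prop :=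
  A = A ^t* /\ forall a : R[i], eigenvalue A a -> 0 <= a.

(* All traces of interest are those of Hermitian matrices, hence real. *)
Definition rtr (R : realType) (N : nat) (A : 'M[R[i]]_N) : R :=
  complex.Re (\tr A).

Definition matrix_norm (R : realType) (N : nat) (nrm : 'M[R[i]]_N -> R) : Prop :=
  [/\ forall X, 0 <= nrm X,
      forall X, nrm X = 0 -> X = 0,
      forall X Y, nrm (X + Y) <= nrm X + nrm Y &
      forall (a : R[i]) X, nrm (a *: X) = complex.Re `|a| * nrm X].

Definition unitarily_invariant_norm (R : realType) (N : nat)
    (nrm : 'M[R[i]]_N -> R) : Prop :=
  matrix_norm nrm /\
  forall U V X : 'M[R[i]]_N, U \is unitarymx -> V \is unitarymx ->
    nrm (U *m X *m V) = nrm X.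

(* B is a version of [A]_r: it is optimal simultaneously for every unitarily
   invariant norm.  Such a B need not be unique when the r-th and (r+1)-st
   singular values of A coincide, which is why this is a predicate. *)
Definition best_rank_approx (R : realType) (N r : nat)
    (A B : 'M[R[i]]_N) : Prop :=
  (\rank B <= r)%N /\
  forall nrm : 'M[R[i]]_N -> R, unitarily_invariant_norm nrm ->
    forall X : 'M[R[i]]_N, (\rank X <= r)%N -> nrm (A - B) <= nrm (A - X).

(* Pivots are numbered from 0: s 0 is the pivot of the first step.
   Once the residual of a psd matrix is 0, v = 0 and the approximation stays
   constant, whatever the pivot. *)
Fixpoint pivoted_cholesky (R : realType) (N : nat) (A : 'M[R[i]]_N)
    (s : nat -> 'I_N) (i : nat) : 'M[R[i]]_N :=
  if i is j.+1 then
    let Ahat := pivoted_cholesky A s j in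
    let v := col (s j) (A - Ahat) in
    Ahat + (v (s j) ord0)^-1 *: (v *m v ^t*)
  else 0.

Definition pivot_weight (R : realType) (N : nat) (A : 'M[R[i]]_N)
    (s : nat -> 'I_N) (i : nat) (t : 'I_N) : R :=
  let Ahat := pivoted_cholesky A s i in
  complex.Re (A t t - Ahat t t) / rtr (A - Ahat).

Definition cond_prob d (T : measurableType d) (R : realType)
    (P : probability T R) (E F : set T) : R :=
  fine (P (E `&` F)) / fine (P F).

(* The random pivots of the first k steps.  Conditioning on the past means
   conditioning on the values u 0, ..., u (i - 1) of the previous pivots.  The
   law of a pivot is unconstrained when the residual has zero trace, where the
   sampling weights are undefined (0 / 0). *)
Definition rp_pivots d (T : measurableType d) (R : realType)
    (P : probability T R) (N : nat) (A : 'M[R[i]]_N) (k : nat)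
    (s : nat -> T -> 'I_N) : Prop :=
  (forall i t, (i < k)%N -> measurable [set w | s i w = t]) /\
  (forall (i : nat) (u : nat -> 'I_N) (t : 'I_N), (i < k)%N ->
    let past := [set w | forall j, (j < i)%N -> s j w = u j] in
    (0 < P past)%E ->
    rtr (A - pivoted_cholesky A u i) != 0 ->
    cond_prob P [set w | s i w = t] past = pivot_weight A u i t).

(* Main.v *)
From HB Require Import structures.
Require Import Defs.
From mathcomp Require Import all_boot all_order all_algebra perm ring.
From mathcomp Require Import all_classical all_reals all_analysis.
From mathcomp Require Import complex.

Set Implicit Arguments.
Unset Strict Implicit.
Unset Printing Implicit Defensive.

Import Order.TTheory GRing.Theory Num.Theory.

Local Open Scope classical_set_scope.
Local Open Scope ring_scope.

(** Write lambda_1 >= ... >= lambda_N for the eigenvalues of A, and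
    Lambda_j for the tail sum of the lambda_i with i > j.

    The algorithm chooses the pivots u_1, ..., u_k with probability
    W(u) / (tr_0 ... tr_(k-1)), where tr_j is the trace of the residual after j
    steps and W(u) is the product of the pivot entries, each read off the
    residual current at its step ([past_prob_le]).  The proof bounds numerators
    and denominators separately.

    - Numerators.  The sum of W(u) over all k-tuples u is k! e_k(lambda), with
      e_k the elementary symmetric function ([sum_pivot_prod]).  This is an
      induction on k: with B / t the Schur complement of B at t, the sum over t
      of B_tt det(1 + x B / t) is the derivative of det(1 + x B)
      ([deriv_elem_sym_poly]), by the formula for the determinant of a rank-one
      update and the Jacobi formula for the derivative of a determinant.
      Moreover e_k(lambda) <= Lambda_0 ... Lambda_(r-1) Lambda_r^(k-r) / (k-r)!
      ([elem_sym_le_tails]).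
    - Denominators.  After j steps a psd matrix B is left, and A - B has rank at
      most j, so tr_j >= Lambda_j by a Ky Fan inequality ([trace_ge_tail]).  On
      the event of the theorem each tr_j is also at least (1 + eps) tau with
      tau = tr(A - [A]_r), because traces of residuals decrease.  Using the
      first bound for j < r and the second one for j >= r, the denominator is
      at least Lambda_0 ... Lambda_(r-1) ((1 + eps) tau)^(k-r).

    As tau >= Lambda_r, dividing and summing over the tuples of the event leaves
    k! / (k-r)! (1 + eps)^-(k-r) ([sum_tuples_le]).

    The inequality tau >= Lambda_r only uses that [A]_r is optimal for the
    Frobenius norm: then [A]_r = P A for an orthogonal projection P of rank at
    most r ([frob_optimal_projection]), and the Ky Fan inequality [ky_fan]
    applies to tr((1 - P) A).

    Positive semidefinite matrices are handled as Gram matrices X^* X: Schur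
    complements preserve this form, the square factor becoming Q X for a
    projection Q. *)

(** * Elementary symmetric functions of a list *)

Definition elem_sym (R : nzRingType) (l : seq R) (k : nat) : R :=
  (\prod_(x <- l) (1 + x *: 'X) : {poly R})`_k.

Lemma elem_sym_nil (R : nzRingType) k : elem_sym [::] k = (k == 0)%:R :> R.
Proof. by rewrite /elem_sym big_nil coef1. Qed.

Lemma elem_sym_cons0 (R : nzRingType) (x : R) l : elem_sym (x :: l) 0 = elem_sym l 0.
Proof. by rewrite /elem_sym big_cons mulrDl mul1r -scalerAl coefD coefZ coefXM mulr0 addr0. Qed.

Lemma elem_sym_consS (R : nzRingType) (x : R) l k :
  elem_sym (x :: l) k.+1 = elem_sym l k.+1 + x * elem_sym l k.
Proof. by rewrite /elem_sym big_cons mulrDl mul1r -scalerAl coefD coefZ coefXM. Qed.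

Section ElemSymBounds.
Variable R : numDomainType.
Implicit Type l : seq R.

Lemma elem_sym_ge0 l k : all (>= 0) l -> 0 <= elem_sym l k.
Proof.
elim: l k => [|x l IH] k /=; first by rewrite elem_sym_nil ler0n.
case/andP=> x0 /IH l0; case: k => [|k]; first by rewrite elem_sym_cons0.
by rewrite elem_sym_consS addr_ge0 ?mulr_ge0.
Qed.

Lemma sum_ge0_all l : all (>= 0) l -> 0 <= \sum_(x <- l) x.
Proof. by move/allP=> l0; rewrite big_seq sumr_ge0// => x /l0. Qed.

Lemma all_drop (T : Type) (p : pred T) n (l : seq T) : all p l -> all p (drop n l).
Proof. by rewrite -{1}(cat_take_drop n l) all_cat => /andP[]. Qed.

(** The two lowest terms of the binomial expansion in x; the others are
    nonnegative. *)
Lemma lerD_exprS (s x : R) k : 0 <= s -> 0 <= x ->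
  s ^+ k.+1 + (s ^+ k * x) *+ k.+1 <= (s + x) ^+ k.+1.
Proof.
move=> s0 x0; elim: k => [|k IH]; first by rewrite !expr1 expr0 mul1r mulr1n.
rewrite [leRHS]exprS; apply: le_trans (ler_wpM2l (addr_ge0 s0 x0) IH).
rewrite -[_ *+ k.+2]mulr_natr -[_ *+ k.+1]mulr_natr -[k.+2%:R]natr1 -subr_ge0.
set a := s ^+ k; set n : R := k.+1%:R.
have -> : (s + x) * (s ^+ k.+1 + a * x * n) -
  (s ^+ k.+2 + s ^+ k.+1 * x * (n + 1)) = a * x * x * n.
  by rewrite !exprS -/a; ring.
by rewrite !mulr_ge0 ?exprn_ge0 ?ler0n.
Qed.

(** Each monomial of e_k occurs k! times in the expansion of the k-th power. *)
Lemma elem_sym_le_expr l k : all (>= 0) l ->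
  k`!%:R * elem_sym l k <= (\sum_(x <- l) x) ^+ k.
Proof.
elim: l k => [|x l IH] k /=.
  by rewrite elem_sym_nil big_nil expr0n; case: k => [|k] /=; rewrite ?mulr1 ?mulr0.
case/andP=> x0 l0; have s0 := sum_ge0_all l0.
case: k => [|k]; first by rewrite elem_sym_cons0 expr0; exact: (IH 0).
rewrite elem_sym_consS big_cons mulrDr addrC [x + _]addrC.
apply: le_trans (lerD_exprS k s0 x0); rewrite addrC lerD ?IH//.
rewrite -[leRHS]mulr_natl factS natrM -mulrA ler_wpM2l ?ler0n//=.
by rewrite mulrCA mulrC ler_wpM2r ?IH.
Qed.

Lemma elem_sym_behead_le l k : all (>= 0) l -> elem_sym (behead l) k <= elem_sym l k.
Proof.
case: l => [|x l]//= /andP[x0 l0]; case: k => [|k]; first by rewrite elem_sym_cons0.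
by rewrite elem_sym_consS lerDl mulr_ge0 ?elem_sym_ge0.
Qed.

(** A squarefree monomial of degree k.+1 is its first factor times a monomial in
    strictly later entries, and these avoid the head of the list. *)
Lemma elem_symS_le_behead l k : all (>= 0) l ->
  elem_sym l k.+1 <= (\sum_(x <- l) x) * elem_sym (behead l) k.
Proof.
elim: l => [|x l IH]; first by rewrite elem_sym_nil big_nil mul0r.
case/andP=> x0 l0; rewrite elem_sym_consS big_cons mulrDl addrC lerD2l/=.
apply: le_trans (IH l0) _.
by rewrite ler_wpM2l ?sum_ge0_all ?elem_sym_behead_le.
Qed.

(** Peeling off the first r factors of a monomial: the i-th one comes from
    position i or later, and what remains lives beyond position r. *)
Lemma elem_symD_le_drop l r m : all (>= 0) l ->
  elem_sym l (r + m) <= (\prod_(i < r) \sum_(x <- drop i l) x) * elem_sym (drop r l) m.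
Proof.
elim: r l => [|r IH] l l0; first by rewrite big_ord0 mul1r drop0.
rewrite big_ord_recl/= drop0 -mulrA addSn.
apply: le_trans (elem_symS_le_behead _ l0) _.
rewrite ler_wpM2l ?sum_ge0_all//.
have dropS n : drop n.+1 l = drop n (behead l) by case: (l); rewrite ?drop_nil.
under eq_bigr do rewrite dropS; rewrite dropS; apply: IH.
by rewrite -drop1 all_drop.
Qed.

Lemma elem_sym_le_tails l r m : all (>= 0) l ->
  m`!%:R * elem_sym l (r + m) <=
  (\prod_(i < r) \sum_(x <- drop i l) x) * (\sum_(x <- drop r l) x) ^+ m.
Proof.
move=> l0; apply: le_trans (ler_wpM2l (ler0n _ _) (elem_symD_le_drop r m l0)) _.
rewrite mulrCA ler_wpM2l ?elem_sym_le_expr ?all_drop//.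
by apply: prodr_ge0 => i _; rewrite sum_ge0_all ?all_drop.
Qed.
End ElemSymBounds.

(** * Derivatives and rank-one updates of determinants *)

Lemma deriv_big_prod (R : comNzRingType) (I : finType) (F : I -> {poly R}) :
  (\prod_i F i)^`() = \sum_i (F i)^`() * \prod_(j | j != i) F j.
Proof.
suff H (s : seq I) : uniq s -> (\prod_(i <- s) F i)^`() =
    \sum_(i <- s) (F i)^`() * \prod_(j <- s | j != i) F j.
  by rewrite H ?index_enum_uniq.
elim: s => [|i s IH]; first by rewrite !big_nil derivC.
case/andP=> iNs us; rewrite !big_cons derivM IH// eqxx; congr (_ * _ + _).
  rewrite [LHS]big_seq [RHS]big_seq_cond; apply: eq_bigl => j.
  by rewrite andbC; case: eqVneq => [->|]; rewrite // (negPf iNs).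
rewrite big_distrr/= !big_seq; apply: eq_bigr => j js.
rewrite big_cons ifT; first by rewrite mulrCA.
by apply: contraNneq iNs => ->.
Qed.

(** Jacobi formula.  The derivative of a determinant is the sum of the
    determinants in which one row is differentiated; expanding each along that
    row produces the cofactors of M. *)
Lemma deriv_det (R : comNzRingType) n (M : 'M[{poly R}]_n) :
  (\det M)^`() = \tr (\adj M *m map_mx (@deriv R) M).
Proof.
pose D i := \matrix_(a, b) if a == i then (M a b)^`() else M a b.
transitivity (\sum_i \det (D i)).
  rewrite /determinant exchange_big/= raddf_sum/=; apply: eq_bigr => s _.
  rewrite -mulr_sumr.
  have -> p : ((-1) ^+ (odd_perm s) * p)^`() = (-1) ^+ (odd_perm s) * p^`() :> {poly R}.
    by case: odd_perm; rewrite ?expr0 ?expr1 ?mul1r // !mulN1r derivN.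
  rewrite deriv_big_prod; congr (_ * _); apply: eq_bigr => i _.
  rewrite [RHS](bigD1 i)//= mxE eqxx; congr (_ * _); apply: eq_bigr => j ji.
  by rewrite mxE (negPf ji).
rewrite /mxtrace; under [RHS]eq_bigr do rewrite mxE.
rewrite [RHS]exchange_big/=; apply: eq_bigr => i _.
rewrite (expand_det_row _ i); apply: eq_bigr => j _.
rewrite !mxE eqxx mulrC /cofactor; congr (_ * \det _ * _).
by apply/matrixP=> a b; rewrite !mxE eq_sym (negPf (neq_lift _ _)).
Qed.

(** Matrix determinant lemma, by eliminating in two ways in the block matrix
    with rows (M, -u) and (v, 1).  The elimination that clears v multiplies the
    last row by det M, which must therefore be cancelled at the end. *)
Lemma det_rank1_update (R : idomainType) n (M : 'M[R]_n) (u : 'cV_n) (v : 'rV_n) :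
  \det M != 0 -> \det (M + u *m v) = \det M + (v *m \adj M *m u) 0 0.
Proof.
move=> dM; apply: (mulfI dM).
pose B := block_mx M (- u) v 1%:M.
have <- : \det B = \det (M + u *m v).
  have: \det (block_mx 1%:M u 0 1%:M *m B) = \det (block_mx (M + u *m v) 0 v 1%:M).
    rewrite mulmx_block !mul1mx !mul0mx !add0r mulmx1.
    by rewrite addNr.
  by rewrite det_mulmx det_ublock det_lblock !det1 !mulr1 mul1r.
have: \det (block_mx 1%:M 0 (- (v *m \adj M)) (\det M)%:M *m B) =
  \det (block_mx M (- u) 0 (v *m \adj M *m u + (\det M)%:M)).
  rewrite mulmx_block !mul1mx !mul0mx !addr0 mulmx1 !mulNmx mulmxN opprK.
  by rewrite -[v *m \adj M *m M]mulmxA mul_adj_mx mul_mx_scalar mul_scalar_mx addNr.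
rewrite det_mulmx det_lblock det_ublock det1 mul1r det_scalar1 => ->.
by rewrite det_mx11 !mxE eqxx mulr1n addrC.
Qed.

(** * Characteristic polynomials of Schur complements *)

(** The k-th coefficient is e_k of the eigenvalues, see
    [elem_sym_poly_spectral]. *)
Definition elem_sym_poly (F : nzRingType) n (B : 'M[F]_n) : {poly F} :=
  \det (1%:M + 'X *: map_mx polyC B).

(** The row is used in place of the conjugate of the column, with which it agrees
    on Hermitian matrices: this keeps the determinant identities below valid over
    any field. *)
Definition schur (F : fieldType) n (B : 'M[F]_n) (t : 'I_n) : 'M[F]_n :=
  B - (B t t)^-1 *: (col t B *m row t B).

Section SchurPoly.
Variables (F : fieldType) (n : nat).
Implicit Types (B : 'M[F]_n) (t : 'I_n).

Lemma elem_sym_poly0 B : (elem_sym_poly B)`_0 = 1.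
Proof.
rewrite -horner_coef0 -[LHS]/(horner_eval 0 (\det _)) -det_map_mx -[RHS](det1 F n).
congr (\det _); apply/matrixP=> i j.
by rewrite !mxE/= /horner_eval !hornerE/= hornerMn hornerC.
Qed.

Lemma elem_sym_poly_neq0 B : elem_sym_poly B != 0.
Proof.
have := elem_sym_poly0 B.
by apply: contra_eq_neq => ->; rewrite coef0 eq_sym oner_eq0.
Qed.

Lemma elem_sym_poly_schur B t : (B t t = 0 -> row t B = 0) ->
  let B' := map_mx polyC B in
  B t t *: elem_sym_poly (schur B t) = B t t *: elem_sym_poly B -
    'X * (row t B' *m \adj (1%:M + 'X *: B') *m col t B') 0 0.
Proof.
move=> rt0 B'; set M := 1%:M + _ *: B'.
have [a0|a0] := eqVneq (B t t) 0.
  by rewrite a0 !scale0r /B' -map_row rt0// map_mx0 !mul0mx mxE mulr0 subr0.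
rewrite {1}/elem_sym_poly.
have -> : 1%:M + 'X *: map_mx polyC (schur B t) =
    M + (- ('X * (B t t)^-1%:P) *: col t B') *m row t B'.
  rewrite -scalemxAl -addrA; congr (_ + _); apply/matrixP=> i j.
  rewrite !mxE !big_ord1 !mxE polyCD polyCN polyCM polyCM.
  by rewrite mulrDr mulrN !mulNr !mulrA.
rewrite det_rank1_update ?elem_sym_poly_neq0// scalerDr; congr (_ + _).
rewrite -scalemxAr mxE -mul_polyC.
set y := (_ *m _) 0 0; set c := _^-1%:P.
have ac : (B t t)%:P * c = 1 by rewrite -polyCM divff.
by transitivity (- ('X * y) * ((B t t)%:P * c)); [ring | rewrite ac mulr1].
Qed.

(** Summing [elem_sym_poly_schur] over t gives tr(B) det M - x tr(B adj(M) B) with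
    M = 1 + x B; as M adj(M) = det M, this equals tr(adj(M) B), which is the
    derivative of det M by the Jacobi formula. *)
Lemma deriv_elem_sym_poly B : (forall t, B t t = 0 -> row t B = 0) ->
  (elem_sym_poly B)^`() = \sum_t B t t *: elem_sym_poly (schur B t).
Proof.
move=> rt0; pose B' := map_mx polyC B.
rewrite (eq_bigr _ (fun t _ => elem_sym_poly_schur (rt0 t))) sumrB -scaler_suml -mulr_sumr -/B'.
set M := 1%:M + _; set d := elem_sym_poly B.
have -> : \sum_t (row t B' *m \adj M *m col t B') 0 0 = \tr (B' *m \adj M *m B').
  apply: eq_bigr => t _; rewrite -row_mul mxE [RHS]mxE.
  by apply: eq_bigr => j _; rewrite [row _ _ _ _]mxE [col _ _ _ _]mxE.
rewrite /elem_sym_poly deriv_det -/M -/d.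
have -> : map_mx (@deriv F) M = B'.
  apply/matrixP=> i j; rewrite !mxE derivD derivM derivX mul1r !derivC mulr0.
  by rewrite addr0 -polyC1 -polyCMn derivC add0r.
have /(congr1 (fun Z => \tr (B' *m Z))) := mul_mx_adj M.
rewrite -/d {1}/M mulmxDl mul1mx mulmxDr mxtraceD mul_mx_scalar mxtraceZ.
have -> : \tr B' = (\tr B)%:P.
  by rewrite /mxtrace raddf_sum; apply: eq_bigr => i _; rewrite mxE.
rewrite mulrC mul_polyC => <-; rewrite -!scalemxAl -scalemxAr mxtraceZ.
by rewrite [\tr (B' *m \adj M *m B')]mxtrace_mulC addrK mxtrace_mulC.
Qed.

Lemma coef_elem_sym_poly_schur B m : (forall t, B t t = 0 -> row t B = 0) ->
  \sum_t B t t * (elem_sym_poly (schur B t))`_m = (elem_sym_poly B)`_m.+1 *+ m.+1.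
Proof.
move=> rt0; rewrite -coef_deriv deriv_elem_sym_poly// coef_sum.
by apply: eq_bigr => t _; rewrite coefZ.
Qed.
End SchurPoly.

(** * Gram matrices and the residuals of pivoted Cholesky *)

Lemma big_tuple_cons (T : finType) (V : nmodType) k (f : seq T -> V) :
  \sum_(u : k.+1.-tuple T) f u = \sum_t \sum_(u : k.-tuple T) f (t :: u).
Proof.
rewrite pair_big/= (reindex (fun p : T * k.-tuple T => [tuple of p.1 :: p.2]))//=.
exists (fun u => (thead u, [tuple of behead u])) => [[t u] _|u _] /=.
  by congr pair; apply: val_inj.
by rewrite [in RHS](tuple_eta u).
Qed.
Section Schur.
Local Open Scope sesquilinear_scope.
Variables (C : numClosedFieldType) (n : nat).
Implicit Types (B : 'M[C]_n) (u : seq 'I_n).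

Definition gram B := exists X : 'M[C]_n, B = X ^t* *m X.

Lemma gram_diag (X : 'M[C]_n) t :
  (X ^t* *m X) t t = \sum_i `|X i t| ^+ 2.
Proof. by rewrite mxE; apply: eq_bigr => i _; rewrite !mxE mulrC normCK. Qed.

Lemma gram_diag_ge0 B t : gram B -> 0 <= B t t.
Proof. by case=> X ->; rewrite gram_diag sumr_ge0// => i _; rewrite exprn_ge0. Qed.

Lemma gram_tr_ge0 B : gram B -> 0 <= \tr B.
Proof. by move=> gB; apply: sumr_ge0 => t _; exact: gram_diag_ge0. Qed.

Lemma gram_herm B : gram B -> B ^t* = B.
Proof. by case=> X ->; rewrite trmx_mul map_mxM/= trmxCK. Qed.

Lemma gram_colC B t : gram B -> (col t B) ^t* = row t B.
Proof. by move=> gB; rewrite -[in RHS](gram_herm gB) tr_col map_row. Qed.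

Lemma gram_diag_eq0 (X : 'M[C]_n) t : (X ^t* *m X) t t = 0 -> col t X = 0.
Proof.
rewrite gram_diag => /eqP; rewrite psumr_eq0 => [/allP h|i _]; last first.
  by rewrite exprn_ge0.
apply/matrixP=> i j; rewrite !mxE; apply/eqP.
by have := h i (mem_index_enum _); rewrite expf_eq0/= normr_eq0.
Qed.

Lemma gram_eq0 (X : 'M[C]_n) : X ^t* *m X = 0 -> X = 0.
Proof.
move=> XX; apply/matrixP=> i j; rewrite mxE.
have : col j X = 0 by apply: gram_diag_eq0; rewrite XX mxE.
by move/colP/(_ i); rewrite !mxE.
Qed.

(** A zero pivot carries no weight in [sum_pivot_prod]; this is what makes the
    Schur complement identities hold there too. *)
Lemma gram_row_eq0 B t : gram B -> B t t = 0 -> row t B = 0.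
Proof.
case=> X -> /gram_diag_eq0 c0; rewrite row_mul.
by rewrite -map_row -tr_col c0 trmx0 map_mx0 mul0mx.
Qed.

(** If B = X^* X and c is the t-th column of X, then B_tt = c^* c, and the Schur
    complement is X^* Q X for the projection Q onto the orthogonal of c. *)
Lemma gram_schur B t : gram B -> gram (schur B t).
Proof.
case=> X BE; set a := B t t.
have [a0|a0] := eqVneq a 0.
  by exists X; rewrite /schur -/a a0 invr0 scale0r subr0.
have gB : gram B by exists X.
have ar : a^* = a by rewrite geC0_conj// gram_diag_ge0.
pose c := col t X; pose P := 1%:M - a^-1 *: (c *m c ^t*).
have cc : c ^t* *m c = a%:M.
  rewrite [LHS]mx11_scalar; congr _%:M; rewrite /a BE !mxE.
  by apply: eq_bigr => i _; rewrite !mxE.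
have PT : P ^t* = P.
  rewrite /P linearB/= map_mxB trmx1 map_mx1 linearZ/= map_mxZ trmx_mul map_mxM.
  by rewrite trmxCK fmorphV /= ar.
have PP : P *m P = P.
  rewrite /P mulmxBr mulmx1 mulmxBl mul1mx -scalemxAl -scalemxAr.
  rewrite -mulmxA [c ^t* *m (_ *m _)]mulmxA cc mul_scalar_mx -scalemxAr.
  by rewrite !scalerA mulVf// mulr1 subrr subr0.
exists (P *m X); rewrite trmx_mul map_mxM PT mulmxA -[_ *m P *m P]mulmxA PP.
rewrite /P mulmxBr mulmx1 mulmxBl -BE; congr (_ - _).
rewrite -/a -scalemxAr -scalemxAl; congr (_ *: _).
have -> : col t B = X ^t* *m c by rewrite BE /c !colE mulmxA.
have -> : row t B = c ^t* *m X.
  by rewrite -gram_colC// {1}BE colE -mulmxA -colE trmx_mul map_mxM trmxCK.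
by rewrite !mulmxA.
Qed.

Fixpoint pivot_prod B u : C :=
  if u is t :: u' then B t t * pivot_prod (schur B t) u' else 1.

Definition residual B u := foldl (@schur C n) B u.

Lemma residual_rcons B u t : residual B (rcons u t) = schur (residual B u) t.
Proof. by rewrite /residual foldl_rcons. Qed.

Lemma gram_residual B u : gram B -> gram (residual B u).
Proof. by elim: u B => //= t u IH B /(gram_schur t) /IH. Qed.

Lemma pivot_prod_rcons B u t :
  pivot_prod B (rcons u t) = pivot_prod B u * residual B u t t.
Proof. by elim: u B => [|a u IH] B /=; rewrite ?mulr1 ?mul1r// IH mulrA. Qed.

Lemma pivot_prod_ge0 B u : gram B -> 0 <= pivot_prod B u.
Proof.
elim: u B => [|t u IH] B gB //=.
by rewrite mulr_ge0 ?gram_diag_ge0// IH//; exact: gram_schur.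
Qed.

(** Induction from the first pivot: sum over t of B_tt k! e_k(B / t), where
    [coef_elem_sym_poly_schur] turns the sum into (k + 1) e_(k+1)(B). *)
Lemma sum_pivot_prod B k : gram B ->
  \sum_(u : k.-tuple 'I_n) pivot_prod B u = k`!%:R * (elem_sym_poly B)`_k.
Proof.
elim: k B => [|k IH] B gB.
  rewrite elem_sym_poly0 mulr1 (eq_bigr (fun=> 1)) => [|u _]; last by rewrite tuple0.
  by rewrite big_const card_tuple/= addr0.
rewrite (big_tuple_cons _ (pivot_prod B)).
rewrite (eq_bigr (fun t => k`!%:R * (B t t * (elem_sym_poly (schur B t))`_k))).
  rewrite -mulr_sumr coef_elem_sym_poly_schur; last by move=> t; exact: gram_row_eq0.
  by rewrite -[_ *+ k.+1]mulr_natl mulrA -natrM mulnC -factS.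
by move=> t _; rewrite -mulr_sumr (IH _ (gram_schur t gB)) mulrCA.
Qed.

Lemma rank_residual B u : (\rank (B - residual B u)%R <= size u)%N.
Proof.
elim/last_ind: u => [|u t IH]; first by rewrite subrr mxrank0.
rewrite residual_rcons size_rcons /schur opprB addrCA addrC.
rewrite (leq_trans (mxrank_add _ _))// -[(size u).+1]addn1 leq_add//.
apply: leq_trans (mxrank_scale _ _) _; apply: leq_trans (mxrankM_maxl _ _) _.
exact: rank_leq_col.
Qed.
End Schur.

(** * Spectral decomposition and a Ky Fan inequality *)

Section Spectral.
Local Open Scope sesquilinear_scope.
Variables (C : numClosedFieldType) (n : nat).
Implicit Types (A B P X : 'M[C]_n) (d : 'rV[C]_n).

Lemma herm_spectral A : A ^t* = A ->
  exists U d, [/\ U \is unitarymx & A = U ^t* *m diag_mx d *m U].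
Proof.
move=> hA; have /orthomx_spectralP AE : A \is normalmx by apply/normalmxP; rewrite hA.
exists (spectralmx A), (spectral_diag A); split; first exact: spectral_unitarymx.
by rewrite {1}AE invmx_unitary ?spectral_unitarymx.
Qed.

Lemma unitaryl (U : 'M[C]_n) : U \is unitarymx -> U *m U ^t* = 1%:M.
Proof. by move/unitarymxP. Qed.

Lemma unitaryr (U : 'M[C]_n) : U \is unitarymx -> U ^t* *m U = 1%:M.
Proof. by move/unitarymxP/mulmx1C. Qed.

Lemma eigenvalue_spectral (U : 'M[C]_n) d i : U \is unitarymx ->
  eigenvalue (U ^t* *m diag_mx d *m U) (d 0 i).
Proof.
move=> uU; apply/eigenvalueP; exists (row i U).
  rewrite -row_mul !mulmxA unitaryl// mul1mx row_mul row_diag_mx.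
  by rewrite -scalemxAl -rowE.
apply/eqP=> Ui0; have := congr1 (fun M : 'M[C]_n => M i i) (unitaryl uU).
rewrite !mxE eqxx big1 => [/eqP|j _]; first by rewrite eq_sym oner_eq0.
by have := congr1 (fun M : 'rV_n => M 0 j) Ui0; rewrite !mxE => ->; rewrite mul0r.
Qed.

(** The order of C is partial, but total on nonnegative numbers. *)
Lemma sort_perm d : (forall i, 0 <= d 0 i) ->
  exists s : 'S_n, forall i j : 'I_n, (i <= j)%N -> d 0 (s j) <= d 0 (s i).
Proof.
move=> d0; pose t := [tuple d 0 i | i < n]; pose ge := fun x y : C => y <= x.
have [s ls] : exists s : 'S_n, sort ge t = [tuple tnth t (s i) | i < n] :> seq C.
  by apply/tuple_permP; rewrite perm_sort.
exists s => i j ij.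
have srt : sorted ge (sort ge t).
  apply: (@sort_sorted_in _ [pred x | 0 <= x]).
    by move=> x y x0 y0; rewrite /ge orbC; apply: real_leVge; exact: ger0_real.
  by apply/allP => x /mapP[k _ ->]; rewrite inE.
have := @sorted_leq_nth _ ge _ _ 0 _ srt i j.
rewrite !inE size_sort size_tuple !ltn_ord ls.
rewrite -!tnth_nth !tnth_mktuple; apply=> //.
- by move=> x y z xy yz; exact: le_trans yz xy.
- by move=> x; rewrite /ge.
Qed.

Lemma psd_spectral A : A ^t* = A -> (forall a, eigenvalue A a -> 0 <= a) ->
  exists U d, [/\ U \is unitarymx, A = U ^t* *m diag_mx d *m U,
    forall i, 0 <= d 0 i &
    forall i j : 'I_n, (i <= j)%N -> d 0 j <= d 0 i].
Proof.
move=> hA eA; have [U [d [uU AE]]] := herm_spectral hA.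
have d0 i : 0 <= d 0 i by apply: eA; rewrite AE eigenvalue_spectral.
have [s sd] := sort_perm d0.
exists (row_perm s U), (\row_i d 0 (s i)); split.
- apply/unitarymxP/matrixP=> i j.
  have /matrixP/(_ (s i) (s j)) := unitaryl uU.
  rewrite !mxE (inj_eq perm_inj) => <-.
  by apply: eq_bigr => k _; rewrite !mxE.
- rewrite AE; apply/matrixP=> i j; rewrite mul_mx_diag [LHS]mxE mul_mx_diag [RHS]mxE.
  rewrite [RHS](reindex_inj (@perm_inj _ s^-1%g)).
  by apply: eq_bigr => k _; rewrite !mxE permKV.
- by move=> i; rewrite mxE.
- by move=> i j ij; rewrite !mxE; exact: sd.
Qed.

Lemma gram_spectral (U : 'M[C]_n) d : (forall i, 0 <= d 0 i) ->
  gram (U ^t* *m diag_mx d *m U).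
Proof.
move=> d0; exists (diag_mx (\row_i sqrtC (d 0 i)) *m U).
rewrite trmx_mul map_mxM !mulmxA -[_ *m _ *m diag_mx _ as X in _ = X *m _]mulmxA.
congr (_ *m _ *m _); rewrite tr_diag_mx map_diag_mx mulmx_diag; congr diag_mx.
apply/rowP=> i; rewrite !mxE /= geC0_conj ?sqrtC_ge0//.
by rewrite -expr2 sqrtCK.
Qed.

Lemma elem_sym_poly_spectral (U : 'M[C]_n) d : U \is unitarymx ->
  elem_sym_poly (U ^t* *m diag_mx d *m U) = \prod_i (1 + d 0 i *: 'X).
Proof.
move=> uU; rewrite /elem_sym_poly !map_mxM/=.
set V := map_mx polyC (U ^t*); set W := map_mx polyC U; set D := map_mx _ (diag_mx _).
have VW : V *m W = 1%:M by rewrite -map_mxM unitaryr// map_mx1.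
have -> : 1%:M + 'X *: (V *m D *m W) = V *m (1%:M + 'X *: D) *m W.
  by rewrite mulmxDr mulmxDl mulmx1 VW -scalemxAr -scalemxAl.
rewrite !det_mulmx mulrAC -det_mulmx VW det1 mul1r.
have -> : 1%:M + 'X *: D = diag_mx (\row_i (1 + d 0 i *: 'X)).
  apply/matrixP=> i j; rewrite !mxE; case: eqVneq => [->|]; last first.
    by rewrite !mulr0n polyC0 mulr0 addr0.
  by rewrite !mulr1n mulrC mul_polyC.
by rewrite det_diag; apply: eq_bigr => i _; rewrite mxE.
Qed.

(** In a full-rank factorization P = L K, idempotence amounts to K L = 1. *)
Lemma trace_idempotent P : P *m P = P -> \tr P = (\rank P)%:R.
Proof.
move=> PP.
move: (row_base P) (col_base P) (row_base_free P) (col_base_full P) (mulmx_base P).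
move: (\rank P) => r K L freeR fullL PE; move: PP; rewrite -PE => PP.
have RL : K *m L = 1%:M.
  apply: (row_free_inj freeR); apply: (row_full_inj fullL).
  by rewrite /= mul1mx -[in RHS]PP !mulmxA.
by rewrite mxtrace_mulC RL mxtrace1.
Qed.

(** The orthogonal projection onto the column space of X is the spectral projection
    of X X^* for its nonzero eigenvalues. *)
Lemma range_projection X : exists P,
  [/\ P ^t* = P, P *m P = P, P *m X = X & (\rank P <= \rank X)%N].
Proof.
pose H := X *m X ^t*.
have hH : H ^t* = H by rewrite /H trmx_mul map_mxM trmxCK.
have [U [d [uU HE]]] := herm_spectral hH.
pose e : 'rV[C]_n := \row_i (d 0 i != 0)%:R.
pose P := U ^t* *m diag_mx e *m U.
have mulU (a b : 'rV[C]_n) : (U ^t* *m diag_mx a *m U) *m (U ^t* *m diag_mx b *m U) =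
    U ^t* *m diag_mx (\row_i (a 0 i * b 0 i)) *m U.
  by rewrite !mulmxA mulmxtVK// -[U ^t* *m _ *m _]mulmxA mulmx_diag.
have hP : P ^t* = P.
  rewrite /P !trmx_mul !map_mxM trmxCK mulmxA tr_diag_mx map_diag_mx.
  congr (_ *m diag_mx _ *m _); apply/rowP=> i; rewrite !mxE /=.
  by rewrite conjC_nat.
have PP : P *m P = P.
  rewrite mulU; congr (_ *m diag_mx _ *m _); apply/rowP=> i; rewrite !mxE.
  by case: eqP; rewrite ?mulr0 ?mulr1.
have PH : P *m H = H.
  rewrite HE mulU; congr (_ *m diag_mx _ *m _); apply/rowP=> i; rewrite !mxE.
  by case: eqP => [->|]; rewrite ?mulr0 ?mul1r.
exists P; split=> //.
  pose Z := (P - 1%:M) *m X.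
  suff Z0 : Z = 0 by apply/eqP; rewrite -subr_eq0 -[X in _ - X]mul1mx -mulmxBl -/Z Z0.
  have ZZ : Z *m Z ^t* = 0.
    rewrite /Z trmx_mul map_mxM mulmxA -[_ *m X *m X ^t*]mulmxA -/H mulmxBl PH.
    by rewrite mul1mx subrr mul0mx.
  have /(congr1 (fun W => W ^t*)) : Z ^t* = 0 by apply: gram_eq0; rewrite trmxCK.
  by rewrite trmxCK trmx0 map_mx0.
(* P = X Y, where Y is X^* times the pseudo-inverse of X X^*. *)
have -> : P = X *m (X ^t* *m (U ^t* *m diag_mx (\row_i (d 0 i)^-1) *m U)).
  rewrite mulmxA -/H HE mulU; congr (_ *m diag_mx _ *m _).
  by apply/rowP=> i; rewrite !mxE; case: eqP => [->|/eqP d0]; rewrite ?mul0r ?mulfV.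
exact: mxrankM_maxl.
Qed.

(** Compare with the weights 1 at the first r positions and 0 elsewhere: replacing
    d i by d r increases every term d i (g i - [i < r]). *)
Lemma sum_capped_le d (g : 'I_n -> C) r :
  (forall i, 0 <= d 0 i) -> (forall i j : 'I_n, (i <= j)%N -> d 0 j <= d 0 i) ->
  (forall i, 0 <= g i <= 1) -> \sum_i g i <= r%:R ->
  \sum_i d 0 i * g i <= \sum_(i < n | (i < r)%N) d 0 i.
Proof.
move=> d0 sd g01 sg; case: (ltnP r n) => [rn|nr]; last first.
  rewrite [leRHS](eq_bigl xpredT) => [|i]; last first.
    by rewrite (leq_trans (ltn_ord i)).
  by apply: ler_sum => i _; have /andP[_ g1] := g01 i; rewrite ler_piMr.
pose c := d 0 (Ordinal rn).
have -> : \sum_(i < n | (i < r)%N) d 0 i = \sum_i d 0 i * (i < r)%:R.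
  by rewrite big_mkcond; apply: eq_bigr => i _; case: ifP; rewrite ?mulr1 ?mulr0.
rewrite -subr_le0 -sumrB.
apply: (@le_trans _ _ (\sum_i c * (g i - (i < r)%:R))).
  apply: ler_sum => i _; rewrite -mulrBr.
  have /andP[g0 g1] := g01 i; case: ltnP => ir.
    by rewrite ler_wnM2r ?subr_le0// sd// ltnW.
  by rewrite ler_wpM2r ?subr0// sd.
rewrite -mulr_sumr mulr_ge0_le0 ?d0// sumrB subr_le0.
suff -> : \sum_(i < n) (i < r)%:R = r%:R :> C by [].
rewrite -natr_sum; congr _%:R.
rewrite (eq_bigr (fun i : 'I_n => if (i < r)%N then 1%N else 0%N)) => [|i _]; last by case: ifP.
by rewrite -big_mkcond/= -(big_ord_widen _ (fun=> 1%N) (ltnW rn)) sum1_card card_ord.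
Qed.

(** In the eigenbasis, tr(P A) weights the eigenvalues by the diagonal entries of
    a projection; these lie in [0, 1] and add up to the rank of P, so that
    [sum_capped_le] applies. *)
Lemma ky_fan (U : 'M[C]_n) d P r :
  U \is unitarymx -> (forall i, 0 <= d 0 i) ->
  (forall i j : 'I_n, (i <= j)%N -> d 0 j <= d 0 i) ->
  P ^t* = P -> P *m P = P -> (\rank P <= r)%N ->
  \sum_(i < n | (r <= i)%N) d 0 i <= \tr ((1%:M - P) *m (U ^t* *m diag_mx d *m U)).
Proof.
move=> uU d0 sd hP PP rP; set A := _ *m U.
pose G := U *m P *m U ^t*.
have hG : G ^t* = G by rewrite /G !trmx_mul !map_mxM trmxCK hP mulmxA.
have GG : G *m G = G.
  by rewrite /G !mulmxA mulmxKtV// -[U *m P *m P]mulmxA PP.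
have gG : gram G by exists G; rewrite hG GG.
have gG' : gram (1%:M - G).
  have hG' : (1%:M - G) ^t* = 1%:M - G.
    by rewrite linearB/= map_mxB hG trmx1 map_mx1.
  exists (1%:M - G); rewrite hG'.
  by rewrite mulmxBr mulmx1 mulmxBl mul1mx GG subrr subr0.
have trG : \tr G = (\rank P)%:R.
  by rewrite /G mxtrace_mulC mulmxA unitaryr// mul1mx trace_idempotent.
have trPA : \tr (P *m A) = \sum_i d 0 i * G i i.
  rewrite /A !mulmxA mxtrace_mulC !mulmxA -/G; apply: eq_bigr => i _.
  by rewrite mul_mx_diag mxE mulrC.
have trA : \tr A = \sum_i d 0 i.
  rewrite /A mxtrace_mulC !mulmxA unitaryl// mul1mx mxtrace_diag.
  by [].
rewrite mulmxBl mul1mx linearB/= trPA trA lerBrDr.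
rewrite [leRHS](bigID (fun i : 'I_n => r <= i)%N)/= lerD2l.
under [leRHS]eq_bigl do rewrite -ltnNge.
apply: sum_capped_le => //.
  move=> i; rewrite gram_diag_ge0//= -subr_ge0.
  by have := gram_diag_ge0 i gG'; rewrite !mxE eqxx.
by rewrite -/(\tr G) trG ler_nat.
Qed.
End Spectral.

(** * The Frobenius norm and low-rank approximation *)

Section Frob.
Local Open Scope sesquilinear_scope.
Variables (C : numClosedFieldType) (n : nat).
Implicit Types (A B P X Y : 'M[C]_n) (d : 'rV[C]_n).

Definition frob X : C := sqrtC (\tr (X ^t* *m X)).

Lemma gramM X : gram (X ^t* *m X). Proof. by exists X. Qed.

Lemma frob_ge0 X : 0 <= frob X.
Proof. by rewrite sqrtC_ge0 (gram_tr_ge0 (gramM X)). Qed.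

Lemma tr_gram_eq0 X : \tr (X ^t* *m X) = 0 -> X = 0.
Proof.
move/eqP; rewrite psumr_eq0 => [/allP h|i _]; last exact: gram_diag_ge0 (gramM X).
apply/matrixP=> i j; rewrite mxE.
have /gram_diag_eq0/colP/(_ i) := eqP (h j (mem_index_enum _)).
by rewrite !mxE.
Qed.

Lemma frob_eq0 X : frob X = 0 -> X = 0.
Proof. by move/eqP; rewrite sqrtC_eq0 => /eqP/tr_gram_eq0. Qed.

Lemma frob_scale a X : frob (a *: X) = `|a| * frob X.
Proof.
have aX : (a *: X) ^t* = a^* *: X ^t* by rewrite linearZ/= map_mxZ.
rewrite /frob aX -scalemxAr -scalemxAl mxtraceZ mxtraceZ mulrA.
by rewrite -normCK sqrtCM ?sqrCK ?qualifE/= ?exprn_ge0 ?(gram_tr_ge0 (gramM X)).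
Qed.

Lemma frob_unitary U V X : U \is unitarymx -> V \is unitarymx ->
  frob (U *m X *m V) = frob X.
Proof.
move=> uU uV; rewrite /frob !trmx_mul !map_mxM !mulmxA.
rewrite mxtrace_mulC !mulmxA (unitaryl uV) mul1mx -[X ^t* *m U ^t* *m U]mulmxA.
by rewrite (unitaryr uU) mulmx1.
Qed.

(** Positivity of [dotmx] gives access to the triangle inequality of inner product
    spaces, which [frob_dot] transfers to [frob]. *)
Lemma dotmx_gt0 (u : 'rV[C]_(n * n)) : u != 0 -> 0 < dotmx u u.
Proof.
have E : dotmx u u = \sum_k `|u 0 k| ^+ 2.
  by rewrite dotmxE mxE; apply: eq_bigr => k _; rewrite !mxE normCK.
move=> u0; rewrite lt_def E sumr_ge0 ?andbT => [|k _]; last by rewrite exprn_ge0.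
apply: contra u0; rewrite psumr_eq0 => [/allP h|k _]; last by rewrite exprn_ge0.
apply/eqP/rowP=> k; rewrite mxE; apply/eqP.
by have := h k (mem_index_enum _); rewrite expf_eq0/= normr_eq0.
Qed.
HB.instance Definition _ := isDotProduct.Build C _ (@dotmx C (n * n)) dotmx_gt0.

Lemma frob_dot X : \tr (X ^t* *m X) = dotmx (mxvec X) (mxvec X).
Proof.
transitivity (\sum_i \sum_j X i j * (X i j)^*).
  rewrite exchange_big; apply: eq_bigr => j _; rewrite mxE.
  by apply: eq_bigr => i _; rewrite !mxE mulrC.
rewrite pair_bigA dotmxE mxE (reindex _ (curry_mxvec_bij n n))/=.
by apply: eq_bigr => -[i j] _ /=; rewrite 2!mxE !mxvecE.
Qed.

Lemma frob_triangle X Y : frob (X + Y) <= frob X + frob Y.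
Proof.
rewrite /frob !frob_dot linearD/=.
exact: (triangle_lerif (@dotmx C (n * n)) (mxvec X) (mxvec Y)).
Qed.


(** If P projects onto the range of A - B, then (1 - P) A = (1 - P) B, whose trace
    is at most tr(B) because B is psd. *)
Lemma trace_ge_tail (U : 'M[C]_n) d B r :
  U \is unitarymx -> (forall i, 0 <= d 0 i) ->
  (forall i j : 'I_n, (i <= j)%N -> d 0 j <= d 0 i) ->
  gram B -> (\rank (U ^t* *m diag_mx d *m U - B)%R <= r)%N ->
  \sum_(i < n | (r <= i)%N) d 0 i <= \tr B.
Proof.
move=> uU d0 sd [Y BE]; set A := _ *m U => rAB.
have [P [hP PP PX rP]] := range_projection (A - B).
apply: le_trans (ky_fan uU d0 sd hP PP (leq_trans rP rAB)) _.
have -> : (1%:M - P) *m A = B - P *m B.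
  rewrite mulmxBl mul1mx -[in LHS](subrK B A) mulmxDr PX opprD addrACA.
  by rewrite subrr add0r.
rewrite raddfB/= gerBl -PP -mulmxA mxtrace_mulC.
have -> : P *m B *m P = (Y *m P) ^t* *m (Y *m P).
  by rewrite trmx_mul map_mxM hP BE !mulmxA.
exact: gram_tr_ge0 (gramM _).
Qed.

(** With P the projection onto the range of B, A - B splits orthogonally into
    (1 - P) A and P A - B.  As P A competes with B, the second part vanishes. *)
Lemma frob_optimal_projection A B r : (\rank B <= r)%N ->
  (forall X, (\rank X <= r)%N -> frob (A - B) <= frob (A - X)) ->
  exists P, [/\ P ^t* = P, P *m P = P, (\rank P <= r)%N & B = P *m A].
Proof.
move=> rB opt; have [P [hP PP PB rP]] := range_projection B.
exists P; split=> //; first exact: leq_trans rB.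
pose E := (1%:M - P) *m A; pose Z := P *m (A - B).
have EP : E ^t* *m P = 0.
  rewrite /E trmx_mul map_mxM -mulmxA.
  have -> : (1%:M - P) ^t* = 1%:M - P by rewrite linearB/= map_mxB hP trmx1 map_mx1.
  by rewrite mulmxBl mul1mx PP subrr mulmx0.
have ABE : A - B = E + Z.
  by rewrite /E /Z mulmxBl mulmxBr mul1mx PB addrA subrK.
have APE : A - P *m A = E by rewrite /E mulmxBl mul1mx.
have rPA : (\rank (P *m A) <= r)%N.
  by rewrite (leq_trans (mxrankM_maxl _ _))// (leq_trans rP).
have := opt _ rPA; rewrite APE ABE ler_sqrtC ?qualifE/= ?(gram_tr_ge0 (gramM _))//.
have EZ : E ^t* *m Z = 0 by rewrite /Z mulmxA EP mul0mx.
have ZE : Z ^t* *m E = 0.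
  by rewrite -[LHS]trmxCK trmx_mul map_mxM trmxCK EZ trmx0 map_mx0.
have -> : (E + Z) ^t* *m (E + Z) = E ^t* *m E + Z ^t* *m Z.
  have -> : (E + Z) ^t* = E ^t* + Z ^t* by rewrite linearD/= map_mxD.
  by rewrite mulmxDl !mulmxDr EZ ZE addr0 add0r.
rewrite mxtraceD gerDl => Z_le0.
have /tr_gram_eq0 : \tr (Z ^t* *m Z) = 0.
  by apply/eqP; rewrite eq_le Z_le0 (gram_tr_ge0 (gramM _)).
by rewrite /Z mulmxBr PB => /eqP; rewrite subr_eq0 => /eqP.
Qed.

End Frob.

(** * Summing over the pivot tuples of the event *)

Lemma sum_drop_tuple (V : nmodType) n (l : n.-tuple V) r :
  \sum_(x <- drop r l) x = \sum_(i < n | (r <= i)%N) tnth l i.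
Proof.
rewrite (big_nth 0) size_drop size_tuple.
under eq_bigr do rewrite nth_drop addnC.
rewrite -(big_addn 0 n r xpredT (nth 0 l)) add0n big_geq_mkord/=.
by apply: eq_bigr => i _; rewrite (tnth_nth 0).
Qed.

Section Tail.
Local Open Scope sesquilinear_scope.
Variables (C : numClosedFieldType) (n : nat).
Implicit Types (A B P X Y : 'M[C]_n) (d : 'rV[C]_n).

Lemma trace_schur_le B t : gram B -> \tr (schur B t) <= \tr B.
Proof.
move=> gB; rewrite raddfB/= gerBl mxtraceZ mulr_ge0 ?invr_ge0 ?gram_diag_ge0//.
rewrite -(gram_colC t gB) mxtrace_mulC; apply: sumr_ge0 => i _.
rewrite mxE; apply: sumr_ge0 => j _.
by rewrite !mxE mulrC -normCK exprn_ge0.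
Qed.

Lemma trace_residual_le B u v : gram B -> \tr (residual B (u ++ v)) <= \tr (residual B u).
Proof.
move=> gB; elim/last_ind: v => [|v t IH]; first by rewrite cats0.
rewrite -rcons_cat residual_rcons; apply: le_trans IH.
by apply: trace_schur_le; exact: gram_residual.
Qed.

(** Deterministic core of the theorem: p u stands for the probability of the pivots
    u, c for 1 + eps and tau for tr(A - [A]_r).  Here D is the lower bound on the
    product of the traces of the residuals, valid for all good tuples. *)
Lemma sum_tuples_le (U : 'M[C]_n) d r k (tau c : C) (good : pred (k.-tuple 'I_n))
    (p : k.-tuple 'I_n -> C) :
  let A := U ^t* *m diag_mx d *m U in
  U \is unitarymx -> (forall i, 0 <= d 0 i) ->
  (forall i j : 'I_n, (i <= j)%N -> d 0 j <= d 0 i) -> (r <= k)%N ->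
  \sum_(i < n | (r <= i)%N) d 0 i <= tau -> 0 < tau -> 1 <= c ->
  (forall u, good u -> c * tau <= \tr (residual A u)) ->
  (forall u, good u ->
    p u * \prod_(j < k) \tr (residual A (take j u)) <= pivot_prod A u) ->
  (forall u, 0 <= p u) ->
  \sum_(u | good u) p u <= k`!%:R / (k - r)`!%:R * c ^- (k - r).
Proof.
move=> A uU d0 sd rk tail_tau tau0 c1 tr_ge p_le p_ge0.
have gA : gram A by exact: gram_spectral.
pose l : seq C := [tuple d 0 i | i < n].
have l0 : all (>= 0) l by apply/allP=> x /mapP[i _ ->].
pose tail j := \sum_(x <- drop j l) x.
have tailE j : tail j = \sum_(i < n | (j <= i)%N) d 0 i.
  by rewrite /tail sum_drop_tuple; apply: eq_bigr => i _; rewrite tnth_mktuple.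
have tail0 j : 0 <= tail j by rewrite sum_ge0_all ?all_drop.
have c0 : 0 < c by apply: lt_le_trans c1.
(* tail j vanishes when A has rank at most j; tau is then a positive lower bound
   for the traces, and D can be divided by. *)
pose L j := if tail j == 0 then tau else tail j.
have L0 j : 0 < L j by rewrite /L; case: eqP => // /eqP; rewrite lt_def tail0 andbT.
have tail_le j : tail j <= L j by rewrite /L; case: eqP => // ->; exact: ltW.
have tr_mono u j : good u -> c * tau <= \tr (residual A (take j u)).
  move=> gu; apply: le_trans (tr_ge u gu) _.
  by rewrite -{1}(cat_take_drop j u) trace_residual_le.
have L_le u (j : 'I_k) : good u -> L j <= \tr (residual A (take j u)).
  move=> gu; rewrite /L; case: eqP => _.
    by apply: le_trans (tr_mono u j gu); rewrite ler_peMl// ltW.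
  rewrite tailE; apply: (@trace_ge_tail _ _ U) => //; first exact: gram_residual.
  rewrite (leq_trans (rank_residual _ _))// size_take size_tuple.
  by case: ifP => // /negbT; rewrite -leqNgt.
pose D := (\prod_(j < r) L j) * (c * tau) ^+ (k - r).
have D0 : 0 < D.
  by rewrite mulr_gt0 ?exprn_gt0 ?mulr_gt0//; apply: prodr_gt0.
have pD u : good u -> p u * D <= pivot_prod A u.
  move=> gu; apply: le_trans (p_le u gu); rewrite ler_wpM2l//.
  rewrite -(big_mkord xpredT (fun j => \tr (residual A (take j u)))).
  rewrite (big_cat_nat (n := r))//= big_mkord ler_pM//.
  - by apply: prodr_ge0 => j _; exact: ltW.
  - by rewrite exprn_ge0// mulr_ge0 ?ltW.
  - apply: ler_prod => j _; rewrite ltW//=.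
    exact: (L_le u (widen_ord rk j)).
  - rewrite -prodr_const_nat.
    by apply: ler_prod => j _; rewrite tr_mono// mulr_ge0 ?ltW.
have ek : (elem_sym_poly A)`_k = elem_sym l k.
  rewrite elem_sym_poly_spectral// /elem_sym big_tuple; congr (polyseq _)`_k.
  by apply: eq_bigr => i _; rewrite tnth_mktuple.
have := sum_pivot_prod k gA; rewrite ek => sumE.
have kr0 : 0 < (k - r)`!%:R :> C by rewrite ltr0n fact_gt0.
rewrite mulrAC ler_pdivlMr// -(ler_pM2r D0) mulrAC mulr_suml.
apply: (@le_trans _ _ (k`!%:R * ((k - r)`!%:R * elem_sym l k))).
  rewrite mulrCA -sumE mulrC ler_wpM2l ?ler0n//.
  rewrite [leRHS](bigID good)/= -[leLHS]addr0 lerD ?ler_sum//.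
  by apply: sumr_ge0 => u _; exact: pivot_prod_ge0.
rewrite -mulrA ler_wpM2l ?ler0n// /D exprMn.
rewrite [leRHS]mulrCA mulKf ?expf_neq0 ?gt_eqF//.
have := elem_sym_le_tails r (k - r) l0; rewrite subnKC// => /le_trans; apply.
apply: ler_pM.
- by apply: prodr_ge0 => j _; exact: tail0.
- by rewrite exprn_ge0 ?tail0.
- by apply: ler_prod => j _; rewrite tail0 tail_le.
- by rewrite -/(tail r) lerXn2r ?qualifE/= ?tail0 ?(ltW tau0)// tailE.
Qed.
End Tail.

(** * Complex traces as real numbers *)

Section ComplexReal.
Local Open Scope sesquilinear_scope.
Local Open Scope complex_scope.

Lemma Re_ge0 (R : realType) (z : R[i]) : 0 <= z -> (complex.Re z)%:C = z.
Proof. by move/ger0_real/RRe_real. Qed.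

Lemma le_Re (R : realType) (x y : R[i]) : x <= y -> complex.Re x <= complex.Re y.
Proof. by rewrite lecE => /andP[]. Qed.

Lemma ReD (R : realType) (x y : R[i]) : complex.Re (x + y) = complex.Re x + complex.Re y.
Proof. by case: x y => [? ?] []. Qed.

Lemma frob_unitarily_invariant (R : realType) (N : nat) :
  unitarily_invariant_norm (fun X : 'M[R[i]]_N => complex.Re (frob X)).
Proof.
split; last by move=> U V X uU uV; rewrite frob_unitary.
split.
- by move=> X; have := le_Re (frob_ge0 X).
- move=> X X0; apply: frob_eq0.
  by rewrite -(Re_ge0 (frob_ge0 X)) X0.
- by move=> X Y; rewrite -ReD; apply/le_Re/frob_triangle.
- move=> a X; rewrite frob_scale -{1}(Re_ge0 (normr_ge0 a)) -{1}(Re_ge0 (frob_ge0 X)).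
  by rewrite -rmorphM.
Qed.

Lemma best_rank_approx_trace_ge (R : realType) (N r : nat)
    (U B : 'M[R[i]]_N) (d : 'rV[R[i]]_N) :
  U \is unitarymx -> (forall i, 0 <= d 0 i) ->
  (forall i j : 'I_N, (i <= j)%N -> d 0 j <= d 0 i) ->
  let A := U ^t* *m diag_mx d *m U in best_rank_approx r A B ->
  \sum_(i < N | (r <= i)%N) d 0 i <= (rtr (A - B))%:C.
Proof.
move=> uU d0 sd A [rB opt].
have [||P [hP PP rP BE]] := @frob_optimal_projection _ _ A B r; first by [].
  move=> X rX; have := opt _ (@frob_unitarily_invariant R N) X rX.
  by rewrite -lecR !Re_ge0 ?frob_ge0.
have := ky_fan uU d0 sd hP PP rP; rewrite -/A mulmxBl mul1mx -BE => h.
rewrite /rtr Re_ge0//; apply: le_trans h.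
by apply: sumr_ge0.
Qed.

Lemma residualE (R : realType) (N : nat) (A : 'M[R[i]]_N) (s : nat -> 'I_N) i :
  gram A -> A - pivoted_cholesky A s i = residual A (mkseq s i).
Proof.
move=> gA; elim: i => [|i IH]; first by rewrite subr0.
rewrite mkseqS residual_rcons -IH /= opprD addrA /schur.
set B := A - pivoted_cholesky A s i.
have gB : gram B by rewrite /B IH; exact: gram_residual.
rewrite (gram_colC _ gB); congr (_ - _^-1 *: _).
by rewrite [LHS]mxE.
Qed.

End ComplexReal.

(** * The law of the pivots *)

Section Proba.
Local Open Scope complex_scope.
Context d (T : measurableType d) (R : realType) (P : probability T R).

Lemma fine_probK (X : set T) : measurable X -> (fine (P X))%:E = P X.
Proof. by move=> mX; rewrite fineK// fin_num_measure. Qed.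

Lemma bigsetU_prob_le (I : finType) (Q : pred I) (F : I -> set T) :
  (forall i, measurable (F i)) ->
  (P (\big[setU/set0]_(i | Q i) F i) <= (\sum_(i | Q i) fine (P (F i)))%:E)%E.
Proof.
move=> mF; rewrite -sumEFin.
rewrite (eq_bigr (fun i => P (F i))) => [|i _]; last exact: fine_probK.
suff [] : measurable (\big[setU/set0]_(i | Q i) F i) /\
  (P (\big[setU/set0]_(i | Q i) F i) <= \sum_(i | Q i) P (F i))%E by [].
elim/big_rec2: _ => [|i y X _ [mX Xy]]; first by rewrite measure0.
split; first exact: measurableU.
by apply: le_trans (measureU2 _ _ _) _ => //; rewrite leeD2l.
Qed.

Context (N : nat) (A : 'M[R[i]]_N) (k : nat) (s : nat -> T -> 'I_N).
Hypotheses (gA : gram A) (hs : rp_pivots P A k s).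

Let past (u : nat -> 'I_N) i := [set w | forall j, (j < i)%N -> s j w = u j].

Lemma pastS u i : past u i.+1 = [set w | s i w = u i] `&` past u i.
Proof.
apply/seteqP; split=> w /=.
  by move=> h; split=> [|j ji]; apply: h => //; exact: ltnW.
by move=> [hi h] j; rewrite ltnS leq_eqVlt => /predU1P[->|/h].
Qed.

Lemma measurable_past u i : (i <= k)%N -> measurable (past u i).
Proof.
elim: i => [_|i IH ik].
  by rewrite (_ : past u 0 = setT)//; apply/seteqP; split.
by rewrite pastS; apply: measurableI; [exact: hs.1 | exact: IH (ltnW ik)].
Qed.

(** Chain rule for the conditional probabilities of the pivots.  It is only an
    inequality because a history of probability zero has no conditional law, and
    then the left-hand side vanishes. *)
Lemma past_prob_le u i : (i <= k)%N ->
  (forall j, (j < i)%N -> 0 < \tr (residual A (mkseq u j))) ->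
  (fine (P (past u i)))%:C * \prod_(j < i) \tr (residual A (mkseq u j)) <=
    pivot_prod A (mkseq u i).
Proof.
elim: i => [_ _|i IH ik tr_gt0].
  rewrite big_ord0 mulr1 /= (_ : past u 0 = setT) ?probability_setT//.
  by apply/seteqP; split.
have {}IH := IH (ltnW ik) (fun j ji => tr_gt0 j (ltnW ji)).
have mp := measurable_past u (ltnW ik).
have mp1 := measurable_past u ik.
rewrite mkseqS pivot_prod_rcons big_ord_recr/=.
set B := residual A _.
have gB : gram B by exact: gram_residual.
have Bd0 : 0 <= B (u i) (u i) by exact: gram_diag_ge0.
have pr_ge0 : 0 <= \prod_(j < i) \tr (residual A (mkseq u j)).
  by apply: prodr_ge0 => j _; rewrite ltW// tr_gt0// (ltn_trans (ltn_ord j)).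
have trB : 0 < \tr B by exact: tr_gt0.
suff H : (fine (P (past u i.+1)))%:C * \tr B <= (fine (P (past u i)))%:C * B (u i) (u i).
  rewrite mulrA mulrAC; apply: le_trans (ler_wpM2r pr_ge0 H) _.
  by rewrite mulrAC ler_wpM2r.
have [p0|p0] := eqVneq (P (past u i)) 0%E.
  have -> : P (past u i.+1) = 0%E.
    apply/eqP; rewrite eq_le measure_ge0 andbT -p0.
    by apply: le_measure; rewrite ?inE// pastS; exact: subIsetr.
  by rewrite p0 /= !mul0r.
have Rtr : (rtr B)%:C = \tr B by rewrite /rtr Re_ge0// ltW.
have := hs.2 i u (u i) ik; rewrite /pivot_weight -/(past u i) residualE// -/B.
rewrite lt0e p0 measure_ge0 => /(_ isT).
have -> : rtr B != 0 by apply: contraTneq trB => B0; rewrite -Rtr B0 ltxx.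
move=> /(_ isT); rewrite /cond_prob -pastS.
have -> : A (u i) (u i) - pivoted_cholesky A u i (u i) (u i) = B (u i) (u i).
  by rewrite /B -residualE// !mxE.
move=> E.
have fp0 : fine (P (past u i)) != 0.
  by apply: contra p0 => /eqP f0; rewrite -fine_probK// f0.
have rB0 : rtr B != 0 by apply: contraTneq trB => B0; rewrite -Rtr B0 ltxx.
rewrite -(Re_ge0 Bd0) -Rtr -!rmorphM lecR.
by rewrite -(divfK fp0 (fine (P (past u i.+1)))) E mulrAC divfK// mulrC.
Qed.
End Proba.

(** * The tail bound *)

Theorem theorem1p2 (R : realType) (N : nat) (A : 'M[R[i]]_N) (hA : psdmx A)
    (r : nat) (hr : (1 <= r)%N) (eps : R) (heps : 0 < eps)
    (k : nat) (hk : (r <= k)%N)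
    (Ar : 'M[R[i]]_N) (hAr : best_rank_approx r A Ar)
    (* the degenerate case (rank A <= r and r < k) is excluded: there the event
       below has probability one while the bound may be smaller than one *)
    (hdeg : (r < k)%N -> 0 < rtr (A - Ar))
    (d : measure_display) (T : measurableType d) (P : probability T R)
    (s : nat -> T -> 'I_N) (hs : rp_pivots P A k s) :
  (P [set w | ((1 + eps) * rtr (A - Ar) <=
              rtr (A - pivoted_cholesky A (fun i => s i w) k))%R]
   <= (k`!%:R / (k - r)`!%:R * (1 + eps) ^- (k - r))%:E)%E.
Proof.
have [U [D [uU AE D0 sD]]] := psd_spectral (esym hA.1) hA.2.
have gA : gram A by rewrite AE; exact: gram_spectral.
have c1 : 1 <= 1 + eps by rewrite lerDl ltW.
set E := [set w | _].
have [->|/set0P[w0 _]] := eqVneq E set0.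
  rewrite measure0 lee_fin !mulr_ge0 ?invr_ge0 ?exprn_ge0 ?ler0n//.
  exact: le_trans c1.
(* A tuple becomes a pivot sequence on nat by repeating some pivot, here
   s 0 w0, beyond position k. *)
pose piv (u : seq 'I_N) := nth (s 0%N w0) u.
have pivK (u : k.-tuple 'I_N) j : (j <= k)%N -> mkseq (piv u) j = take j u.
  move=> jk; apply: (@eq_from_nth _ (s 0%N w0)) => [|i].
    by rewrite size_mkseq size_takel// size_tuple.
  by rewrite size_mkseq => ij; rewrite nth_mkseq// nth_take.
have pivKk (u : k.-tuple 'I_N) : mkseq (piv u) k = u.
  by rewrite pivK// -{1}(size_tuple u) take_size.
pose F (u : k.-tuple 'I_N) := [set w | forall j, (j < k)%N -> s j w = piv u j].
have mF u : measurable (F u) by exact: (measurable_past hs).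
pose good : pred (k.-tuple 'I_N) :=
  fun u => (1 + eps) * rtr (A - Ar) <= rtr (residual A u).
have EE : E = \big[setU/set0]_(u | good u) F u.
  rewrite -(bigcup_pred good); apply/seteqP; split=> w.
    rewrite /E /= residualE// => gw.
    have uE : [tuple s i w | i < k] = mkseq (s^~ w) k :> seq _.
      by rewrite /mkseq -val_enum_ord -map_comp.
    exists [tuple s i w | i < k]; first by rewrite /= unfold_in /good uE.
    move=> j jk; rewrite /piv uE nth_mkseq//.
  case=> u; rewrite /= unfold_in /good => gu Fu; rewrite /E/= residualE//.
  suff -> : mkseq (fun i => s i w) k = u by [].
  rewrite -[RHS]pivKk; apply/eq_in_map => j; rewrite mem_iota add0n => /andP[_ jk].
  exact: Fu.
have mE : measurable E by rewrite EE; apply: bigsetU_measurable.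
(* For k = r the right-hand side is k!, which is at least 1. *)
have [rk|kr] := ltnP r k; last first.
  have -> : k = r by apply/eqP; rewrite eqn_leq kr hk.
  rewrite subnn fact0 expr0 !divr1.
  apply: le_trans (probability_le1 P mE) _.
  by rewrite lee_fin ler1n fact_gt0.
have tau0 := hdeg rk.
rewrite EE; apply: le_trans (bigsetU_prob_le P good mF) _; rewrite lee_fin -lecR.
rewrite rmorph_sum/= !rmorphM/= !fmorphV rmorphXn/= !rmorph_nat.
have AB : \sum_(i < N | (r <= i)%N) D 0 i <= (rtr (A - Ar))%:C%C.
  by have := @best_rank_approx_trace_ge R N r U Ar D uU D0 sD; rewrite -AE => /(_ hAr).
apply: (@sum_tuples_le _ _ U D r k (rtr (A - Ar))%:C%C) => //.
- by rewrite ltcR.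
- by rewrite -[1]/(1%:C%C) lecR.
- move=> u gu; rewrite -AE -[X in _ <= X]Re_ge0 ?gram_tr_ge0//; last exact: gram_residual.
  by rewrite -rmorphM lecR.
- move=> u gu; rewrite -AE.
  have := @past_prob_le _ T R P N A k s gA hs (piv u) k (leqnn k).
  rewrite pivKk; under eq_bigr => j _ do rewrite pivK ?(ltnW (ltn_ord j))//.
  apply=> j jk; rewrite pivK; last exact: ltnW.
  have : \tr (residual A u) <= \tr (residual A (take j u)).
    by rewrite -{1}(cat_take_drop j u) trace_residual_le.
  apply: lt_le_trans.
  rewrite -[X in _ < X]Re_ge0 ?gram_tr_ge0//; last exact: gram_residual.
  by rewrite ltcR; apply: lt_le_trans gu; rewrite mulr_gt0// (lt_le_trans _ c1).
- by move=> u; rewrite ler0c fine_ge0.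
Qed.
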